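(* Let $G$ be a finite abelian group and $H$ a subgroup of $G$. Suppose that $|G|>2$. Then the following are equivalent: (1) $\Gamma^+_{G,H}$ is connected; (2) $\Gamma_{G,H}$ is connected; (3) $H=G$.
   Context: Groups are written additively with identity $0$. For a finite abelian group $G$ and a subgroup $H$, $\Gamma^+_{G,H}$ (the extended subgroup sum graph) is the simple graph with vertex set $G$ in which distinct $x,y$ are adjacent iff $x+y\in H$; $\Gamma_{G,H}$ (the subgroup sum graph) is the simple graph with vertex set $G$ in which distinct $x,y$ are adjacent iff $x+y\in H\setminus\{0\}$. *)

(* Defs.v *)
From mathcomp Require Import all_boot all_fingroup all_algebra.

Set Implicit Arguments.
Unset Strict Implicit.
Unset Printing Implicit Defensive.

Import GRing.Theory.
Local Open Scope ring_scope.

(* [e] is the adjacency relation of a simple graph with vertex set [T];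
   [connect e] is its reflexive transitive closure. *)
Definition connected_graph (T : finType) (e : rel T) : Prop :=
  (0 < #|T|)%N /\ forall x y : T, connect e x y.

(* The finite abelian group is the whole of [V : finZmodType]; [{group V}] is
   the type of its subgroups, for the group law [+%R] of [V]. *)
Definition ext_subgroup_sum_graph (V : finZmodType) (H : {group V}) : rel V :=
  [rel x y | (x != y) && (x + y \in H)].

Definition subgroup_sum_graph (V : finZmodType) (H : {group V}) : rel V :=
  [rel x y | (x != y) && (x + y \in H :\ 0)].

Lemma ext_subgroup_sum_graph_sym (V : finZmodType) (H : {group V}) :
  symmetric (ext_subgroup_sum_graph H).
Proof. by move=> x y; rewrite /ext_subgroup_sum_graph /= eq_sym addrC. Qed.

Lemma ext_subgroup_sum_graph_irr (V : finZmodType) (H : {group V}) :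
  irreflexive (ext_subgroup_sum_graph H).
Proof. by move=> x; rewrite /ext_subgroup_sum_graph /= eqxx. Qed.

Lemma subgroup_sum_graph_sym (V : finZmodType) (H : {group V}) :
  symmetric (subgroup_sum_graph H).
Proof. by move=> x y; rewrite /subgroup_sum_graph /= eq_sym addrC. Qed.

Lemma subgroup_sum_graph_irr (V : finZmodType) (H : {group V}) :
  irreflexive (subgroup_sum_graph H).
Proof. by move=> x; rewrite /subgroup_sum_graph /= eqxx. Qed.

(* Main.v *)
Require Import Defs.
From mathcomp Require Import all_boot all_fingroup all_algebra.

(** The subgroup [H] is a union of connected components of the extended graph:
    if [x + y] and one of [x], [y] lie in [H], then so does the other. As
    [0 \in H], the extended graph can only be connected when [H] is the whole
    group. Conversely, when [H] is the whole group, the vertex [0] is adjacent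
    in the subgroup sum graph to every [y != 0], because [0 + y = y] is a nonzero
    element of [H]; so this graph contains a spanning star. Finally, the subgroup
    sum graph is a subgraph of the extended one, with the same vertices. *)

Import GRing.Theory.
Local Open Scope ring_scope.

Lemma closed_ext_subgroup_sum_graph (V : finZmodType) (H : {group V}) :
  closed (ext_subgroup_sum_graph H) (mem H).
Proof.
move=> x y /andP[_ Hxy]; apply/idP/idP => [Hx | Hy].
  (* [x + y] is convertible to the group product of [x] and [y]. *)
  by rewrite -(groupMl y Hx).
by rewrite -(groupMr x Hy).
Qed.

Lemma ext_connected_full (V : finZmodType) (H : {group V}) :
  connected_graph (ext_subgroup_sum_graph H) -> H = [set: V] :> {set V}.
Proof.
move=> [_ conn]; apply/setP=> y; rewrite inE.
rewrite -(closed_connect (closed_ext_subgroup_sum_graph V H) (conn 0 y)).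
exact: group1.
Qed.

Lemma full_connected (V : finZmodType) (H : {group V}) :
  H = [set: V] :> {set V} -> connected_graph (subgroup_sum_graph H).
Proof.
move=> defH.
have conn0 y : connect (subgroup_sum_graph H) 0 y.
  have [<- | y_neq0] := eqVneq 0 y; first exact: connect0.
  have Hy : y \in H by rewrite defH inE.
  apply: connect1; rewrite /subgroup_sum_graph /= y_neq0 add0r.
  by rewrite in_setD1 eq_sym y_neq0.
split=> [|x y]; first by apply/card_gt0P; exists 0.
apply: connect_trans (conn0 y).
by rewrite (sym_connect_sym (subgroup_sum_graph_sym H)) conn0.
Qed.

Lemma connected_ext (V : finZmodType) (H : {group V}) :
  connected_graph (subgroup_sum_graph H) ->
  connected_graph (ext_subgroup_sum_graph H).
Proof.
move=> [V_gt0 conn]; split=> // x y.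
apply: connect_sub (conn x y) => {}x {}y /andP[neq_xy /setD1P[_ Hxy]].
by apply: connect1; rewrite /ext_subgroup_sum_graph /= neq_xy.
Qed.

Local Close Scope ring_scope.

Theorem proposition4p1 (V : finZmodType) (H : {group V}) (hV : 2 < #|V|) :
  [<-> connected_graph (ext_subgroup_sum_graph H);
       connected_graph (subgroup_sum_graph H);
       H = [set: V] :> {set V}].
Proof.
tfae.
- by move/ext_connected_full/full_connected.
- by move/connected_ext/ext_connected_full.
- by move/full_connected/connected_ext.
Qed.
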